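(* Every odd squarefree integer $n\ge 4849845$ satisfies $$\frac{\sigma(n)}{n\log\log n} < \frac{e^\gamma}{2}.$$
   Context: $\sigma(n)$ denotes the sum of the positive divisors of $n$, $\gamma$ is the Euler–Mascheroni constant, and $\log$ is the natural logarithm. *)

(* Defs.v *)
From mathcomp Require Import all_boot all_order all_algebra.
From mathcomp Require Import all_classical all_reals all_analysis.

Set Implicit Arguments.
Unset Strict Implicit.
Unset Printing Implicit Defensive.

Import Order.TTheory GRing.Theory Num.Theory.
Import numFieldNormedType.Exports.

Local Open Scope ring_scope.

Definition squarefree (n : nat) : Prop :=
  forall d : nat, (d ^ 2 %| n)%N -> d = 1%N.

Definition sigma (n : nat) : nat := (\sum_(d <- divisors n) d)%N.

(* [series harmonic n] has n terms: 1 + 1/2 + ... + 1/n. *)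
Definition euler_gamma_seq (R : realType) : R ^nat :=
  fun n => series harmonic n - ln n%:R.

Definition euler_gamma (R : realType) : R := limn (@euler_gamma_seq R).

(* [lim] is total: this lemma makes [euler_gamma] a genuine limit. *)
Lemma is_cvg_euler_gamma_seq (R : realType) : cvgn (@euler_gamma_seq R).
Proof.
have p n : 0 < n.+1%:R :> R by rewrite ltr0n.
have lnB (a b : R) : 0 < a -> 0 < b -> ln a - ln b <= (a - b) / b.
  move=> a0 b0; rewrite -ln_div ?posrE// mulrBl divff ?gt_eqF//.
  rewrite -{1}(subrKC 1 (a / b)) le_ln1Dx// ltrBrDl subrr.
  exact: divr_gt0.
have serS n : series harmonic n.+1 = series harmonic n + n.+1%:R^-1 :> R.
  by rewrite !seriesEnat /= big_nat_recr.
have ser_ge n : ln n.+1%:R <= series harmonic n :> R.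
  elim: n => [|n IH]; first by rewrite ln1 seriesEnat /= big_geq.
  rewrite serS; have := lnB _ _ (p n.+1) (p n).
  rewrite -[n.+2%:R]natr1 [_ + 1 - _]addrAC subrr add0r mul1r lerBlDr.
  by move=> /le_trans->//; rewrite addrC lerD2r.
suff /cvg_ex[l ul] : cvgn [sequence @euler_gamma_seq R n.+1]_n.
  by apply/cvg_ex; exists l; rewrite -cvg_shiftS.
apply: nonincreasing_is_cvgn.
  apply/nonincreasing_seqP => n; rewrite /euler_gamma_seq /= [_ n.+2]serS.
  have := lnB _ _ (p n) (p n.+1).
  rewrite -[X in (_ - X) / _]natr1 opprD addrA subrr add0r mulN1r.
  by rewrite lerBlDr => h; rewrite -addrA lerD2l -lerN2 opprK opprB addrC.
exists 0 => _ [n _ <-]; rewrite /euler_gamma_seq /= subr_ge0.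
by apply: le_trans (ser_ge n.+1); rewrite ler_ln ?posrE// ler_nat.
Qed.

(* Main.v *)
Require Import Defs.
From mathcomp Require Import all_boot all_order all_algebra.
From mathcomp Require Import all_classical all_reals all_analysis.
From mathcomp Require Import ring lra zify.
From Stdlib Require Import BinNat Nnat.

Import Order.TTheory GRing.Theory Num.Theory.
Import numFieldNormedType.Exports.

Local Open Scope ring_scope.

(* Importing BinNat rebinds these delimiters. *)
Delimit Scope N_scope with num.
Delimit Scope nat_scope with N.

(**
For squarefree [n], [sigma n / n] is the product of [1 + 1/p] over [p | n], and
exchanging the prime divisors of an odd [n] for the odd primes up to a suitable
[y >= 19] increases this product without increasing [n].  So it suffices that
[P(y) < 0.888 ln (theta(y))] for [y >= 19], where [P] is the product of [1 + 1/p]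
and [theta] the sum of [ln p] over the odd primes [p <= y], together with
[exp(gamma) / 2 >= 0.888].  Asymptotically [P(y) ~ 0.722 ln y], so there is a 20
percent margin and elementary estimates are enough.  For [y <= 2^14] the inequality
is checked by a fixed-point computation, sharp only at [y = 19].  Beyond, [n!] and
Chebyshev's [prod_(p <= n) p <= 4^n] give [sum_(p <= n) ln p / p <= ln n], which
partial summation started at [2^14] turns into an upper bound for [P(y)], while the
central binomial coefficient gives [theta(y) >= 0.61 y].
*)

(** * Squarefree numbers *)

(** As [p] does not divide [m], the divisors of [p * m] split into those of [m] and their multiples
    by [p]. *)
Lemma sigma_primeM p m : prime p -> ~~ (p %| m)%N -> (0 < m)%N ->
  sigma (p * m) = (p.+1 * sigma m)%N.
Proof.
move=> pp pm m0.
have p0 := prime_gt0 pp.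
have divM : perm_eq (divisors (p * m)) (divisors m ++ map (muln p) (divisors m)).
  apply: uniq_perm; first exact: divisors_uniq.
    rewrite cat_uniq divisors_uniq map_inj_uniq ?divisors_uniq ?andbT /=.
      apply/hasPn => _ /mapP[d _ ->]; rewrite /= -dvdn_divisors //.
      by apply: contra pm => /(dvdn_trans (dvdn_mulr d (dvdnn p))).
    by move=> x y /eqP; rewrite eqn_pmul2l // => /eqP.
  move=> d; rewrite mem_cat -!dvdn_divisors ?muln_gt0 ?p0 //.
  apply/idP/orP.
    have [/dvdnP[e ->]|pd] := boolP (p %| d)%N.
      rewrite mulnC dvdn_pmul2l // => em; right.
      by apply/mapP; exists e => //; rewrite -dvdn_divisors.
    by rewrite Gauss_dvdr ?[coprime d p]coprime_sym ?prime_coprime //; left.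
  case=> [dm|/mapP[e]]; first by rewrite dvdn_mull.
  by rewrite -dvdn_divisors // => em ->; rewrite dvdn_pmul2l.
rewrite /sigma (perm_big _ divM) big_cat big_map /= -big_distrr /=.
by rewrite mulSn.
Qed.

Lemma sigma_prod_primes (s : seq nat) : uniq s -> all prime s ->
  sigma (\prod_(p <- s) p) = (\prod_(p <- s) p.+1)%N.
Proof.
elim: s => [|p s IH] /=; first by rewrite !big_nil /sigma big_seq1.
move=> /andP[ps us] /andP[pp sp]; rewrite !big_cons sigma_primeM ?IH //.
  rewrite Euclid_dvd_prod // big_has; apply: contra ps => /hasP[q qs].
  by rewrite dvdn_prime2 ?(allP sp q qs) // => /eqP ->.
by rewrite big_seq prodn_cond_gt0 // => q /(allP sp)/prime_gt0.
Qed.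

Lemma squarefree_prod_primes n : (0 < n)%N -> squarefree n ->
  n = (\prod_(p <- primes n) p)%N.
Proof.
move=> n0 sq; rewrite {1}[n]prod_prime_decomp // prime_decompE big_map /=.
rewrite big_seq [RHS]big_seq; apply: eq_bigr => p pn.
have := pn; rewrite mem_primes => /and3P[pp _ _].
have l0 : (0 < logn p n)%N by rewrite logn_gt0.
suff : (logn p n <= 1)%N by case: (logn p n) l0 => [|[]].
rewrite leqNgt; apply/negP => l2.
have /sq p1 : (p ^ 2 %| n)%N by rewrite pfactor_dvdn.
by rewrite p1 in pp.
Qed.

(** * Exchange of prime divisors and reduction to the odd primes up to [y] *)

Section Rearrangement.
Variable R : realType.

(* Exchange argument: the elements of [s] missing from [q] contribute factors at
   most [c], those of [q] missing from [s] factors at least [c]. *)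
Lemma prod_exchange_le (T : eqType) (f : T -> R) (c : R) (s q : seq T) :
  uniq s -> uniq q -> 0 < c -> c ^+ size s <= c ^+ size q ->
  {in q, forall x, c <= f x} ->
  {in s, forall x, x \notin q -> 0 <= f x <= c} ->
  \prod_(p <- s) f p <= \prod_(p <- q) f p.
Proof.
move=> us uq c0 cle fq fs.
have com : perm_eq [seq x <- s | x \in q] [seq x <- q | x \in s].
  apply: uniq_perm; rewrite ?filter_uniq // => x.
  by rewrite !mem_filter andbC.
have q0 x : x \in q -> 0 <= f x by move=> /fq; apply: le_trans; exact: ltW.
rewrite (bigID (mem q)) [leRHS](bigID (mem s)) /=.
rewrite -big_filter (perm_big _ com) big_filter ler_wpM2l //.
  by rewrite big_seq_cond prodr_ge0 // => x /andP[/q0].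
apply: (@le_trans _ _ (c ^+ count (fun x => x \notin q) s)).
  rewrite -iter_mulr_1 -big_const_seq.
  rewrite big_seq_cond [leRHS]big_seq_cond; apply: ler_prod => x /andP[xs xq]; exact: fs.
apply: (@le_trans _ _ (c ^+ count (fun x => x \notin s) q)); last first.
  rewrite -iter_mulr_1 -big_const_seq.
  rewrite big_seq_cond [leRHS]big_seq_cond; apply: ler_prod => x /andP[xq _].
  by rewrite ltW //= fq.
move: cle; rewrite -(count_predC (mem q) s) -(count_predC (mem s) q) !exprD.
have -> : count (mem s) q = count (mem q) s.
  by rewrite -!size_filter; symmetry; exact: perm_size.
by rewrite ler_pM2l // exprn_gt0.
Qed.

End Rearrangement.

Definition odd_primes (y : nat) : seq nat := [seq p <- index_iota 3 y.+1 | prime p].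

Lemma mem_odd_primes y p : (p \in odd_primes y) = [&& prime p, odd p & (p <= y)%N].
Proof.
rewrite mem_filter mem_index_iota ltnS; case: (boolP (prime p)) => //= pp.
congr (_ && _); apply/idP/idP => [p3|op].
  by have := even_prime pp; lia.
by have := prime_gt1 pp; case: p op {pp} => [|[|[]]].
Qed.

Lemma odd_primesS y : odd_primes y.+1 =
  if (2 <= y)%N && prime y.+1 then rcons (odd_primes y) y.+1 else odd_primes y.
Proof.
rewrite /odd_primes /index_iota; have [y2|y2] := leqP 2 y; last first.
  by case: y y2 => [|[|]].
have -> : (y.+2 - 3 = (y.+1 - 3) + 1)%N by rewrite addn1 subSn.
rewrite iotaD filter_cat subnKC // andTb.
have -> : [seq p <- iota y.+1 1 | prime p] = if prime y.+1 then [:: y.+1] else [::] by [].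
by case: ifP => _; rewrite ?cats0 ?cats1.
Qed.

Lemma odd_primes_uniq y : uniq (odd_primes y).
Proof. by rewrite filter_uniq // iota_uniq. Qed.

Lemma size_odd_primes_homo : {homo (fun y => size (odd_primes y)) : x y / (x <= y)%N}.
Proof.
apply: (@homo_leq _ _ (fun a b : nat => (a <= b)%N)) => [x|y x z|y].
- exact: leqnn.
- exact: leq_trans.
by rewrite odd_primesS; case: ifP => //; rewrite size_rcons.
Qed.

(** The count grows by at most one at each integer, so the least [z] where it reaches [k] hits [k]
    exactly. *)
Lemma exists_size_odd_primes k y : (0 < k <= size (odd_primes y))%N ->
  exists z, size (odd_primes z) = k.
Proof.
move=> /andP[k0 ky].
have /ex_minnP[z kz zmin] : exists z, (k <= size (odd_primes z))%N by exists y.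
exists z; apply/eqP; rewrite eqn_leq kz andbT.
case: z kz zmin => [|z]; first by rewrite /odd_primes /= => _ _; exact: ltnW.
move=> kz /(_ z); rewrite ltnn => zmin.
have : ~~ (k <= size (odd_primes z))%N by apply/negP => /zmin.
by rewrite odd_primesS; case: ifP => _; rewrite ?size_rcons -ltnNge // => /ltnW.
Qed.

Section Reduction.
Variable R : realType.

Definition mertens_prod y : R := \prod_(p <- odd_primes y) (1 + p%:R^-1).

Definition odd_theta y : R := \sum_(p <- odd_primes y) ln p%:R.

Lemma odd_primes_gt0 y p : p \in odd_primes y -> 0 < p%:R :> R.
Proof. by rewrite mem_odd_primes ltr0n => /and3P[/prime_gt0]. Qed.

Lemma odd_theta_ln y : odd_theta y = ln (\prod_(p <- odd_primes y) p)%:R.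
Proof.
rewrite /odd_theta; have := @odd_primes_gt0 y.
elim: (odd_primes y) => [|p s IH] s0; first by rewrite !big_nil ln1.
rewrite !big_cons natrM lnM ?posrE ?IH //.
- by move=> q qs; apply: s0; rewrite inE qs orbT.
- by apply: s0; rewrite inE eqxx.
rewrite natr_prod big_seq prodr_gt0 // => q qs.
by apply: s0; rewrite inE qs orbT.
Qed.

Lemma sigma_div_primes n : (0 < n)%N -> squarefree n ->
  (sigma n)%:R / n%:R = \prod_(p <- primes n) (1 + p%:R^-1) :> R.
Proof.
move=> n0 sq; rewrite [in LHS](squarefree_prod_primes _ n0 sq).
rewrite sigma_prod_primes ?primes_uniq ?all_prime_primes //.
rewrite !natr_prod -prodf_div big_seq [RHS]big_seq; apply: eq_bigr => p.
rewrite mem_primes => /andP[/prime_gt0 p0 _].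
by rewrite -[p.+1%:R]natr1 mulrDl divff ?mul1r // pnatr_eq0 -lt0n.
Qed.

(** If [n] has at most seven prime divisors, [y = 19] works: the seven odd primes up to 19 have
    product 4849845. Otherwise [y] is chosen with exactly as many odd primes as [n] has prime
    divisors. *)
Lemma sigma_bound (c : R) (n : nat) :
  0 <= c ->
  (forall y, (19 <= y)%N -> mertens_prod y < c * ln (odd_theta y)) ->
  odd n -> squarefree n -> 4849845%:R <= n%:R :> R ->
  (sigma n)%:R / n%:R < c * ln (ln n%:R).
Proof.
move=> c0 H on sq nbig; have n0 : (0 < n)%N by case: n on {sq nbig}.
suff [y [y19 prodn Sy]] : exists y, [/\ (19 <= y)%N,
    (\prod_(p <- odd_primes y) p)%:R <= n%:R :> R &
    (sigma n)%:R / n%:R <= mertens_prod y].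
  apply: le_lt_trans Sy _; apply: lt_le_trans (H _ y19) _.
  have prod0 : 0 < (\prod_(p <- odd_primes y) p)%:R :> R.
    by rewrite natr_prod big_seq prodr_gt0 // => p /odd_primes_gt0.
  (* Since [ln] is 0 on nonpositive reals, [H] would otherwise make a product of nonnegative factors
     negative. *)
  have th0 : 0 < odd_theta y.
    rewrite ltNge; apply/negP => th0; have := H _ y19.
    by rewrite ln0 // mulr0 ltNge /mertens_prod big_seq prodr_ge0.
  have le1 : odd_theta y <= ln n%:R.
    by rewrite odd_theta_ln ler_ln ?posrE // ltr0n.
  have ln0 : 0 < ln n%:R :> R by exact: lt_le_trans th0 le1.
  by apply: (ler_wpM2l c0); rewrite ler_ln ?posrE.
have fle (p y : nat) : (0 < p)%N -> (p <= y)%N -> 1 + y%:R^-1 <= 1 + p%:R^-1 :> R.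
  by move=> p0 py; rewrite lerD2l lef_pV2 ?posrE ?ltr0n ?ler_nat // (leq_trans p0).
have exch y : (size (primes n) <= size (odd_primes y))%N ->
    (sigma n)%:R / n%:R <= mertens_prod y.
  move=> sz; rewrite sigma_div_primes //.
  apply: (@prod_exchange_le _ _ _ (1 + y%:R^-1)); rewrite ?primes_uniq ?odd_primes_uniq //.
  - by rewrite ler_weXn2l // lerDl invr_ge0.
  - move=> p; rewrite mem_odd_primes => /and3P[pp _ py].
    exact: fle (prime_gt0 pp) py.
  move=> p; rewrite mem_primes => /and3P[pp _ pn]; rewrite mem_odd_primes pp /=.
  have op : odd p by apply: dvdn_odd pn on.
  rewrite op /= -ltnNge => yp; rewrite addr_ge0 ?invr_ge0 //=.
  (* At [y = 0] the threshold degenerates to 1, but then [sz] says that [n] has no prime divisor,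
     contrary to [p]. *)
  case: y sz yp => [|y] sz yp; last by apply: fle => //; exact: ltnW.
  by move: pp sz; rewrite /odd_primes /= leqn0 size_eq0 => pp /eqP s0;
    move: (mem_primes p n); rewrite s0 pp n0 pn.
have [small|big] := leqP (size (primes n)) 7.
  exists 19%N; split=> //; last exact: exch.
  rewrite (_ : odd_primes 19 = [:: 3; 5; 7; 11; 13; 17; 19]%N) //.
  by rewrite natr_prod !big_cons big_nil; lra.
have [y sy] : exists y, size (odd_primes y) = size (primes n).
  apply: (@exists_size_odd_primes _ n); rewrite (leq_trans _ big) //=.
  apply: uniq_leq_size; first exact: primes_uniq.
  move=> p; rewrite mem_primes mem_odd_primes => /and3P[-> _ pn] /=.
  by rewrite (dvdn_odd pn on) dvdn_leq.
exists y; split; last by apply: exch; rewrite sy.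
  rewrite leqNgt; apply/negP => /ltnW /size_odd_primes_homo.
  by rewrite sy [leqRHS]/= leqNgt big.
have y0 : (0 < y)%N by case: y sy big => // <-.
have gt0 (s : seq nat) : {in s, forall p, 0 < p}%N -> 0 < (\prod_(p <- s) p)%:R :> R.
  by move=> s0; rewrite ltr0n big_seq prodn_cond_gt0.
have pn0 : {in primes n, forall p, 0 < p}%N.
  by move=> p; rewrite mem_primes => /andP[/prime_gt0].
have po0 : {in odd_primes y, forall p, 0 < p}%N.
  by move=> p; rewrite mem_odd_primes => /andP[/prime_gt0].
(* Inverting both products gives another exchange, of factors [1 / p] with threshold [1 / y],
   between lists of equal length. *)
rewrite [in leRHS](squarefree_prod_primes _ n0 sq) -lef_pV2 ?posrE ?gt0 //.
rewrite !natr_prod -!prodfV.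
apply: (@prod_exchange_le _ _ _ y%:R^-1); rewrite ?primes_uniq ?odd_primes_uniq //.
- by rewrite invr_gt0 ltr0n.
- by rewrite sy.
- move=> p po; rewrite lef_pV2 ?posrE ?ltr0n ?ler_nat ?(po0 p po) //.
  by move: po; rewrite mem_odd_primes => /and3P[].
move=> p; rewrite mem_primes => /and3P[pp _ pn].
rewrite mem_odd_primes pp (dvdn_odd pn on) /= -ltnNge => yp.
rewrite invr_ge0 ler0n lef_pV2 ?posrE ?ltr0n ?ler_nat //; first exact: ltnW.
exact: prime_gt0.
Qed.
End Reduction.

(** * Logarithms *)

Section LogExp.
Variable R : realType.
Implicit Types x y : R.

Lemma expR_ge_taylor x n : 0 <= x ->
  \sum_(0 <= i < n) x ^+ i / i`!%:R <= expR x.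
Proof.
move=> x0; have := @nondecreasing_cvgn_le R (series (exp_coeff x)).
move=> /(_ _ _ n); rewrite /expR seriesEnat /=; apply.
  apply: nondecreasing_series => k _ _.
  by rewrite /exp_coeff /= divr_ge0 // exprn_ge0.
by have := is_cvg_series_exp_coeff x; rewrite seriesEnat.
Qed.

(* Since [n! >= 2^(n-1)], the exponential series is dominated by a geometric one. *)
Lemma expR_le_pade x : 0 <= x < 2 -> expR x <= (1 + x / 2) / (1 - x / 2).
Proof.
move=> /andP[x0 x2]; set t := x / 2.
have t0 : 0 <= t by rewrite divr_ge0.
have t1 : 0 < 1 - t by rewrite /t; lra.
have factS n : (2 ^ n <= n.+1`!)%N.
  by elim: n => // n IH; rewrite expnS factS leq_mul.
have geo n : \sum_(0 <= i < n.+1) t ^+ i <= (1 - t)^-1.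
  have -> : (1 - t)^-1 = \sum_(0 <= i < n.+1) t ^+ i + t ^+ n.+1 / (1 - t).
    elim: n => [|n IH]; first by rewrite big_nat1 expr0 expr1; field; lra.
    rewrite [LHS]IH (big_nat_recr n.+1) //= -addrA; congr (_ + _).
    by rewrite (exprS _ n.+1); field; lra.
  by rewrite lerDl divr_ge0 ?exprn_ge0 // ltW.
have term i : x ^+ i / i`!%:R <= if i is 0%N then 1 else 2 * t ^+ i.
  case: i => [|i]; first by rewrite fact0 divr1.
  have -> : 2 * t ^+ i.+1 = x ^+ i.+1 / 2 ^+ i.
    by rewrite /t expr_div_n [2 ^+ i.+1]exprS invfM mulrCA; congr (_ * _); rewrite mulVKf.
  rewrite ler_wpM2l ?exprn_ge0 // lef_pV2 ?posrE ?ltr0n ?fact_gt0 ?exprn_gt0 //.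
  by rewrite -natrX ler_nat.
rewrite /expR; apply: limr_le; first exact: is_cvg_series_exp_coeff.
near=> n; rewrite seriesEnat /= -(prednK (n := n)); last by near: n; exact: nbhs_infty_gt.
rewrite big_nat_recl //=.
have -> : (1 + t) / (1 - t) = 1 + 2 * ((1 - t)^-1 - 1) by field; lra.
apply: lerD; first exact: (term 0%N).
apply: le_trans (_ : 2 * (\sum_(0 <= i < n.-1.+1) t ^+ i - 1) <= _).
  rewrite big_nat_recl // expr0 addrC addKr mulr_sumr.
  by apply: ler_sum => i _; exact: (term i.+1).
by rewrite ler_pM2l // lerD2r.
Unshelve. all: by end_near.
Qed.

Lemma ln_sub_le x y : 0 < x -> 0 < y -> ln x - ln y <= (x - y) / y.
Proof.
move=> x0 y0; rewrite -ln_div ?posrE //.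
have -> : x / y = 1 + (x - y) / y by field; lra.
apply: le_ln1Dx; rewrite ltr_pdivlMr //; lra.
Qed.

Lemma ln2_gt : 693 / 1000 < ln 2 :> R.
Proof.
rewrite -ltr_expR lnK ?posrE //.
have -> : expR (693 / 1000) = expR (693 / 1000 / 16) ^+ 16 :> R.
  by rewrite -expRM_natl mulrCA divff // mulr1.
(* The exponent is divided by 16 to make the rational bound sharp enough; its value there is
   [(32000 + 693) / (32000 - 693)]. *)
have [a [a0 ea a2]] : exists a : R, [/\ 0 <= a,
    (1 + 693 / 1000 / 16 / 2) / (1 - 693 / 1000 / 16 / 2) <= a & a ^+ 16 < 2].
  exists (32693%:R / 31307%:R); split; [lra| |lra].
  by rewrite ler_pdivrMr; lra.
apply: le_lt_trans a2; rewrite lerXn2r ?nnegrE ?expR_ge0 //.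
by apply: le_trans ea; apply: expR_le_pade; lra.
Qed.

Lemma ln2_lt : ln 2 < 1733 / 2500 :> R.
Proof.
rewrite -ltr_expR lnK ?posrE //; have := @expR_ge_taylor (1733 / 2500) 8.
rewrite !big_nat_recr //= big_nil => /(_ _); rewrite /factorial /= => h.
by apply: lt_le_trans (h _); lra.
Qed.

End LogExp.

(** * Chebyshev and Mertens estimates *)

Lemma prod_primes_dvdn (s : seq nat) m : uniq s -> all prime s ->
  {in s, forall p, p %| m}%N -> (\prod_(p <- s) p %| m)%N.
Proof.
elim: s => [|p s IH] /=; first by rewrite big_nil dvd1n.
move=> /andP[ps us] /andP[pp sp] dv; rewrite big_cons Gauss_dvd.
  rewrite dv ?inE ?eqxx // IH // => q qs.
  by rewrite dv // inE qs orbT.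
rewrite prime_coprime // Euclid_dvd_prod // big_has; apply: contra ps => /hasP[q qs].
by rewrite dvdn_prime2 ?(allP sp q qs) // => /eqP ->.
Qed.

Definition primorial n : nat := (\prod_(p <- iota 0 n.+1 | prime p) p)%N.

Lemma primorialS n :
  primorial n.+1 = (primorial n * if prime n.+1 then n.+1 else 1)%N.
Proof.
rewrite /primorial -(addn1 n.+1) iotaD big_cat; congr (_ * _)%N.
by rewrite big_mkcond big_seq1 add0n.
Qed.

(** This coefficient occurs twice, at [m] and [m + 1], in a row of sum [2 * 4 ^ m]. *)
Lemma bin_odd_le m : ('C(m.*2.+1, m) <= 4 ^ m)%N.
Proof.
have : ('C(m.*2.+1, m) + 'C(m.*2.+1, m.+1) <= 2 ^ m.*2.+1)%N.
  have -> : (2 ^ m.*2.+1 = \sum_(i < m.*2.+2) 'C(m.*2.+1, i))%N.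
    rewrite -[2%N]/(1 + 1)%N expnDn; apply: eq_bigr => i _.
    by rewrite !exp1n !muln1.
  have hm : (m < m.*2.+2)%N by lia.
  have hm1 : (m.+1 < m.*2.+2)%N by lia.
  rewrite (bigD1 (Ordinal hm)) //= (bigD1 (Ordinal hm1)) /=; first by rewrite addnA leq_addr.
  by rewrite -val_eqE /= eqn_leq ltnn.
have -> : 'C(m.*2.+1, m.+1) = 'C(m.*2.+1, m).
  by rewrite -[RHS]bin_sub; [congr 'C(_, _); lia|lia].
by rewrite addnn expnS mul2n leq_double -mul2n expnM.
Qed.

Lemma prime_dvdn_fact p n : prime p -> (p %| n`!)%N -> (p <= n)%N.
Proof.
move=> pp; elim: n => [|n IH]; first by rewrite fact0 dvdn1; case: eqP pp => // ->.
by rewrite factS Euclid_dvdM // => /orP[/dvdn_leq->//|/IH]; exact: leqW.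
Qed.

(** Strong induction due to Erdős: an even [n > 2] is not prime, and for [n = 2m + 1] the primes in
    [(m + 1, n]] all divide ['C(n, m)], which is at most [4 ^ m]. *)
Lemma primorial_le n : (primorial n <= 4 ^ n)%N.
Proof.
have [k] := ubnP n; elim: k n => // k IH n; rewrite ltnS => nk.
have [n2|n2] := leqP n 2.
  by case: n n2 {nk} => [|[|[]]] // _; rewrite /primorial /= !big_cons big_nil.
have [on|en] := boolP (odd n); last first.
  case: n nk n2 en => // n nk n2 en; rewrite primorialS.
  have /negbTE -> : ~~ prime n.+1.
    by apply: contra en => /even_prime[e|//]; move: n2; rewrite e.
  by rewrite muln1 (leq_trans (IH n nk)) // leq_exp2l.
have := odd_double_half n; rewrite on add1n; set m := n./2 => nE.
have mn : (m.+1 < n)%N by lia.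
have -> : primorial n = (primorial m.+1 * \prod_(p <- iota m.+2 (n - m.+1) | prime p) p)%N.
  by rewrite /primorial (_ : n.+1 = m.+2 + (n - m.+1))%N ?iotaD ?big_cat //; lia.
have -> : (4 ^ n = 4 ^ m.+1 * 4 ^ m)%N by rewrite -expnD; congr (_ ^ _)%N; lia.
rewrite leq_mul //; first by apply: IH; lia.
apply: leq_trans (bin_odd_le m); apply: dvdn_leq; first by rewrite bin_gt0; lia.
rewrite -big_filter; apply: prod_primes_dvdn.
- by rewrite filter_uniq // iota_uniq.
- exact: filter_all.
move=> p; rewrite mem_filter mem_iota => /andP[pp pm].
have pf : (p %| (m.*2.+1)`!)%N by apply: dvdn_fact; have := prime_gt0 pp; lia.
move: pf; rewrite -(@bin_fact m.*2.+1 m); last lia.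
by rewrite !Euclid_dvdM // => /orP[//|/orP[] /(prime_dvdn_fact _ _ pp)]; lia.
Qed.

(** By Legendre's formula the exponent is the sum over [k] of [2n %/ p ^ k - 2 (n %/ p ^ k)]. Each
    term is 0 or 1, and it vanishes once [p ^ k > 2n]. *)
Lemma logn_bin_le p n : prime p -> (0 < n)%N ->
  (logn p 'C(n.*2, n) <= trunc_log p n.*2)%N.
Proof.
move=> pp n0; set T := trunc_log _ _.
have p1 := prime_gt1 pp.
have := @bin_fact n.*2 n; rewrite (_ : n.*2 - n = n)%N; last lia.
move=> /(_ _)/(congr1 (logn p)).
rewrite !lognM ?muln_gt0 ?fact_gt0 ?bin_gt0 // ?(leq_trans _ (leq_addl _ _)) -?addnn ?leq_addl //.
rewrite !logn_fact // => /(_ isT) E.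
suff : (\sum_(1 <= k < (n + n).+1) (n + n) %/ p ^ k <=
        T + (\sum_(1 <= k < n.+1) n %/ p ^ k + \sum_(1 <= k < n.+1) n %/ p ^ k))%N by lia.
have -> : (\sum_(1 <= k < n.+1) n %/ p ^ k = \sum_(1 <= k < (n + n).+1) n %/ p ^ k)%N.
  rewrite [RHS](@big_cat_nat _ _ _ n.+1) //=; last lia.
  rewrite -[LHS]addn0; congr (_ + _)%N.
  rewrite big_nat_cond big1 // => k /andP[/andP[nk _] _].
  by rewrite divn_small // (leq_ltn_trans (ltnW (ltn_expl n p1))) // ltn_exp2l.
have -> : T = (\sum_(1 <= k < (n + n).+1) (k <= T))%N.
  have Tn : (T <= n + n)%N.
    by rewrite /T addnn -[leqRHS](@trunc_expnK p) // leq_trunc_log // ltnW // ltn_expl.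
  rewrite (@big_cat_nat _ _ _ T.+1) //= -[LHS]addn0; congr (_ + _)%N; last first.
    by rewrite big_nat_cond big1 // => k /andP[/andP[Tk _] _]; rewrite leqNgt Tk.
  rewrite big_nat_cond (eq_bigr (fun _ => 1%N)); last first.
    by move=> k /andP[/andP[_ kT] _]; rewrite -ltnS kT.
  by rewrite -big_nat_cond sum_nat_const_nat muln1 subn1.
rewrite -!big_split /=; apply: leq_sum => k _.
case: (leqP k T) => [_|Tk].
  have d0 : (0 < p ^ k)%N by rewrite expn_gt0 prime_gt0.
  by rewrite -ltnS ltn_divLR //; have := ltn_ceil n d0; nia.
rewrite divn_small // addnn ltnNge; apply/negP => pk.
by have := trunc_log_max p1 pk; rewrite leqNgt Tk.
Qed.

Lemma prod_prime_logn m n : (0 < m)%N ->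
  (forall p, prime p -> p %| m -> p <= n)%N ->
  m = (\prod_(p <- iota 0 n.+1 | prime p) p ^ logn p m)%N.
Proof.
move=> m0 mn; rewrite [LHS]prod_prime_decomp // prime_decompE big_map -[RHS]big_filter.
rewrite [RHS](bigID (fun p => p \in primes m)).
rewrite [X in (_ = _ * X)%N]big1 ?muln1.
  rewrite -[RHS]big_filter; apply: perm_big; apply: uniq_perm.
  - exact: primes_uniq.
  - by rewrite !filter_uniq // iota_uniq.
  move=> p; rewrite !mem_filter mem_iota /=.
  case: (boolP (p \in _)) => //= pm; have := pm.
  by rewrite mem_primes => /and3P[pp _ pd]; rewrite pp /= add0n ltnS mn.
by move=> p /=; rewrite -logn_gt0 -eqn0Ngt => /eqP ->.
Qed.

(** A prime above [r] has exponent at most 1 and is absorbed by the primorial. Each of the at most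
    [r] other primes contributes a power not exceeding [2n]. *)
Lemma bin_le_primorial n r : (0 < n)%N -> (n.*2 < r.+1 ^ 2)%N ->
  ('C(n.*2, n) <= primorial n.*2 * n.*2 ^ r)%N.
Proof.
move=> n0 nr.
have C0 : (0 < 'C(n.*2, n))%N by rewrite bin_gt0; lia.
rewrite [leqLHS](@prod_prime_logn _ n.*2) //; last first.
  move=> p pp pd; apply: (prime_dvdn_fact _ _ pp).
  rewrite -(@bin_fact n.*2 n); last lia.
  exact: dvdn_mulr.
apply: (@leq_trans (\prod_(p <- iota 0 n.*2.+1 | prime p) (p * if (p <= r)%N then n.*2 else 1))%N).
  apply: leq_prod => p pp.
  have p1 := prime_gt1 pp.
  case: (leqP p r) => pr.
    rewrite -[leqLHS]mul1n leq_mul ?prime_gt0 //.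
    apply: leq_trans (_ : p ^ trunc_log p n.*2 <= _)%N.
      by rewrite leq_exp2l // logn_bin_le.
    by rewrite trunc_logP // double_gt0.
  rewrite muln1 -[leqRHS]expn1 leq_exp2l // (leq_trans (logn_bin_le _ _ pp n0)) //.
  rewrite -ltnS -(@ltn_exp2l p) // (leq_ltn_trans (trunc_logP p1 _)) ?double_gt0 //.
  by rewrite (leq_trans nr) // leq_exp2r.
rewrite big_split; apply: leq_mul => //; rewrite -big_mkcondr big_const_seq iter_muln_1.
rewrite leq_pexp2l ?double_gt0 // -size_filter -[leqRHS](size_iota 1).
apply: uniq_leq_size; first exact: filter_uniq (iota_uniq _ _).
move=> p; rewrite mem_filter mem_iota => /andP[/andP[pp pr] _].
by rewrite mem_iota prime_gt0.
Qed.

(** Induction through [(n + 1) 'C(2n + 2, n + 1) = 2 (2n + 1) 'C(2n, n)]. *)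
Lemma bin_double_ge n : (0 < n)%N -> (4 ^ n <= n.*2 * 'C(n.*2, n))%N.
Proof.
elim: n => // -[_ _|n IH _]; first by [].
have E : (n.+2 * 'C(n.+2.*2, n.+2) = 2 * n.+1.*2.+1 * 'C(n.+1.*2, n.+1))%N.
  have := mul_bin_diag n.+2.*2 n.+1; have := mul_bin_down n.+1.*2.+1 n.+1.
  rewrite !doubleS /= (_ : n.*2.+3 - n.+1 = n.+2)%N; last lia.
  nia.
have := IH isT; have : (n.+2.*2 * 'C(n.+2.*2, n.+2) = 2 * (n.+2 * 'C(n.+2.*2, n.+2)))%N.
  by rewrite mulnA mul2n.
rewrite (expnS 4 n.+1) E => ->; move: (4 ^ n.+1)%N 'C(n.+1.*2, n.+1) => X C; rewrite -!muln2; nia.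
Qed.

(** * Sums over primes: Chebyshev's function and the sum of [ln p / p] *)

Section PrimeSums.
Variable R : realType.

Definition prime_sum (f : nat -> R) n : R := \sum_(p <- iota 0 n.+1 | prime p) f p.

Lemma prime_sumS f n : prime_sum f n.+1 = prime_sum f n + if prime n.+1 then f n.+1 else 0.
Proof.
rewrite /prime_sum -(addn1 n.+1) iotaD big_cat; congr (_ + _).
by rewrite big_mkcond big_seq1 add0n.
Qed.

Definition theta : nat -> R := prime_sum (fun p => ln p%:R).

Definition mertens_sum : nat -> R := prime_sum (fun p => ln p%:R / p%:R).

Lemma primorial_gt0 n : (0 < primorial n)%N.
Proof. by rewrite prodn_cond_gt0 // => p /prime_gt0. Qed.

Lemma theta_ln n : theta n = ln (primorial n)%:R.
Proof.
elim: n => [|n IH].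
  by rewrite (_ : primorial 0 = 1%N) ?ln1 /theta /prime_sum /primorial big_mkcond big_seq1.
rewrite /theta prime_sumS -/theta IH primorialS natrM lnM ?posrE ?ltr0n ?primorial_gt0 //.
  by case: ifP => _ //; rewrite mulr1n ln1.
by case: ifP.
Qed.

Lemma ln2_ge0 : 0 <= ln 2 :> R.
Proof. by apply: ln_ge0; rewrite ler1n. Qed.

Lemma theta_le n : theta n <= 2 * n%:R * ln 2.
Proof.
rewrite theta_ln (@le_trans _ _ (ln (2 ^+ (2 * n)))) //.
  rewrite ler_ln ?posrE ?ltr0n ?primorial_gt0 ?exprn_gt0 //.
  by rewrite exprM -(natrX _ 2) -natrX ler_nat primorial_le.
by rewrite lnXn // -[_ *+ (2 * n)]mulr_natl natrM.
Qed.

Lemma ln_nat_pow_le (a b p q : nat) : (0 < q)%N -> (0 < p)%N -> (q ^ a <= p ^ b)%N ->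
  a%:R * ln q%:R <= b%:R * ln p%:R :> R.
Proof.
move=> q0 p0 le; rewrite !mulr_natl -!lnXn ?ltr0n // -!natrX.
by rewrite ler_ln ?posrE ?ltr0n ?expn_gt0 ?q0 ?p0 // ler_nat.
Qed.

Lemma ln_prime_ge0 p : 0 <= ln p%:R :> R.
Proof. by case: p => [|p]; [rewrite ln0 | rewrite ln_ge0 ?ler1n]. Qed.

(** Logarithm of [4 ^ n <= 2n 'C(2n, n) <= (2n) ^ (r + 1) * primorial (2n)]. *)
Lemma theta_ge n r : (0 < n)%N -> (n.*2 < r.+1 ^ 2)%N ->
  n.*2%:R * ln 2 - r.+1%:R * ln n.*2%:R <= theta n.*2.
Proof.
move=> n0 nr.
have d0 : (0 < n.*2)%N by rewrite double_gt0.
have le : (2 ^ n.*2 <= n.*2 ^ r.+1 * primorial n.*2)%N.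
  rewrite -mul2n expnM -[(2 ^ 2)%N]/4%N (leq_trans (bin_double_ge _ n0)) //.
  by rewrite expnS -mulnA mul2n leq_mul // mulnC bin_le_primorial.
rewrite theta_ln lerBlDl !mulr_natl -!lnXn ?ltr0n // -lnM ?posrE ?exprn_gt0 ?ltr0n ?primorial_gt0 //.
rewrite -!natrX -natrM ler_ln ?posrE ?ltr0n ?expn_gt0 ?muln_gt0 ?d0 ?primorial_gt0 //.
by rewrite ler_nat.
by rewrite expn_gt0 d0. 
Qed.

Lemma ln_fact_le n : (0 < n)%N -> ln n`!%:R <= n%:R * ln n%:R - n%:R + 1 + ln n%:R :> R.
Proof.
elim: n => // -[_ _|n IH _]; first by rewrite (_ : 1`!%:R = 1) // ln1; lra.
rewrite factS natrM lnM ?posrE ?ltr0n ?fact_gt0 //.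
have := IH isT; have := @ln_sub_le R n.+1%:R n.+2%:R.
rewrite !ltr0n => /(_ isT isT); rewrite -[n.+2%:R]natr1.
have p0 : 0 < n.+1%:R :> R by rewrite ltr0n.
move: (n.+1%:R) p0 => x x0; rewrite ler_pdivlMr; last lra.
by move=> h1 h2; nra.
Qed.

(** In [n!] the exponent of [p] is at least [n %/ p + n %/ p ^ 2]. Rounding in the first quotients
    costs at most [theta n] altogether; the second ones are kept only for 2, 3, 5 and 7. *)
Lemma mul_mertens_sum_le n : (49 <= n)%N ->
  n%:R * mertens_sum n + \sum_(p <- [:: 2; 3; 5; 7]%N) ln p%:R * (n%:R / p%:R ^+ 2 - 1)
    <= ln n`!%:R + theta n.
Proof.
move=> n49; have n0 : (0 < n)%N by apply: leq_trans n49.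
have -> : ln n`!%:R = \sum_(p <- iota 0 n.+1 | prime p) (logn p n`!)%:R * ln p%:R :> R.
  rewrite {1}(@prod_prime_logn n`! n) ?fact_gt0 //; last by move=> p; exact: prime_dvdn_fact.
  elim: (iota _ _) => [|p s IH]; first by rewrite !big_nil ln1.
  rewrite !big_cons; case: ifP => // pp.
  rewrite natrM lnM ?IH ?natrX ?lnXn ?posrE ?exprn_gt0 ?ltr0n ?(prime_gt0 pp) ?mulr_natl //.
  by rewrite prodn_cond_gt0 // => q /prime_gt0; rewrite expn_gt0 => ->.
have divr p : (0 < p)%N -> n%:R / p%:R - 1 <= (n %/ p)%:R :> R.
  move=> p0; rewrite lerBlDr natr1 ler_pdivrMr ?ltr0n // -natrM ler_nat.
  by rewrite ltnW // ltn_ceil.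
have logn_ge p : prime p -> (n %/ p + n %/ p ^ 2 <= logn p n`!)%N.
  move=> pp; rewrite logn_fact // (@big_cat_nat _ _ _ 3) //=; last lia.
  by rewrite big_nat_recr //= big_nat1 expn1 leq_addr.
rewrite /mertens_sum /theta /prime_sum mulr_sumr -lerBrDl.
apply: (@le_trans _ _ (\sum_(p <- iota 0 n.+1 | prime p) (n %/ p ^ 2)%:R * ln p%:R)).
  rewrite -[leRHS]big_filter [leRHS](bigID (mem [:: 2; 3; 5; 7]%N)) /=.
  apply: ler_wpDr; first by rewrite sumr_ge0 // => p _; rewrite mulr_ge0 // ln_prime_ge0.
  rewrite -[leRHS]big_filter.
  have P : perm_eq [seq i <- [seq p <- iota 0 n.+1 | prime p] | i \in [:: 2; 3; 5; 7]%N] [:: 2; 3; 5; 7]%N.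
    apply: uniq_perm => //; first by rewrite !filter_uniq // iota_uniq.
    move=> p; rewrite !mem_filter mem_iota; case: (boolP (p \in _)) => //= p7.
    have : prime p && (p <= 7)%N by move: p p7; apply/allP.
    by move=> /andP[-> p7']; lia.
  rewrite (perm_big _ P) [leLHS]big_seq [leRHS]big_seq; apply: ler_sum => p p7.
  rewrite mulrC ler_wpM2r ?ln_prime_ge0 // -natrX divr // expn_gt0.
  by move: p p7; apply/allP.
rewrite lerBrDl -!big_split /=; apply: ler_sum => p pp.
have := logn_ge p pp; rewrite -(ler_nat R) natrD => h.
have := divr p (prime_gt0 pp) => h2.
have := ln_prime_ge0 p; move: (ln p%:R) => l l0.
rewrite mulrCA; nra.
Qed.

End PrimeSums.

(** * Estimates from [2^14] on and partial summation *)

Section Asymptotic.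
Variable R : realType.

Lemma natr_ge_pow14 n : (2 ^ 14 <= n)%N -> 2 ^+ 14 <= n%:R :> R.
Proof. by move=> h; rewrite -natrX ler_nat. Qed.

(** The bounds on [theta] and [n!] leave an excess of [(2 ln 2 - 1) n], about [0.386 n]. The terms
    of 2, 3, 5 and 7 save about [0.399 n]; the difference absorbs [ln n] and the constants. *)
Lemma mertens_sum_le_ln n : (2 ^ 14 <= n)%N -> mertens_sum R n <= ln n%:R.
Proof.
move=> n14; have X14 := natr_ge_pow14 _ n14.
have n49 : (49 <= n)%N by apply: leq_trans n14.
have n0 : (0 < n)%N by apply: leq_trans n49.
have h := @mul_mertens_sum_le R n n49.
have hf := @ln_fact_le R n n0.
have ht := @theta_le R n.
have hL := @ln_sub_le R n%:R (2 ^+ 14).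
have {hL} hL : ln n%:R - ln 2 *+ 14 <= n%:R / 2 ^+ 14 - 1 :> R.
  rewrite -lnXn //; apply: le_trans (hL _ _) _; rewrite ?ltr0n ?exprn_gt0 //.
  by rewrite mulrBl divff // expf_neq0.
(* From [8 <= 9], [512 <= 625] and [2048 <= 2401]: [ln 3], [ln 5] and [ln 7] are at least 3/2, 9/4
   and 11/4 times [ln 2]. *)
have l3 := @ln_nat_pow_le R 3 2 3 2 isT isT isT.
have l5 := @ln_nat_pow_le R 9 4 5 2 isT isT isT.
have l7 := @ln_nat_pow_le R 11 4 7 2 isT isT isT.
have l2 := ln2_lt R; have l20 := ln2_ge0 R.
move: h; rewrite !big_cons big_nil.
have X0 : 0 < n%:R :> R by rewrite ltr0n.
rewrite -(ler_pM2l X0).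
move: (n%:R) (ln n%:R) (ln 2) (ln 3) (ln 5) (ln 7) (mertens_sum R n) (ln n`!%:R) (theta R n)
  X14 hf ht hL l3 l5 l7 l2 l20 X0 => X L l a b c M F T X14 hf ht hL l3 l5 l7 l2 l20 X0.
have e3 : 3/2 * l * (X / 9 - 1) <= a * (X / 3 ^+ 2 - 1) by nra.
have e5 : 9/4 * l * (X / 25 - 1) <= b * (X / 5 ^+ 2 - 1) by nra.
have e7 : 11/4 * l * (X / 49 - 1) <= c * (X / 7 ^+ 2 - 1) by nra.
have Xl : X * l <= X * (1733 / 2500) by rewrite ler_pM2l // ltW.
move=> h; nra.
Qed.

Lemma prime_sum_odd_primes f y : (2 <= y)%N ->
  prime_sum R f y = f 2%N + \sum_(p <- odd_primes y) f p.
Proof.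
move=> y2; rewrite /prime_sum /odd_primes big_filter /index_iota.
rewrite (_ : y.+1 = 3 + (y.+1 - 3))%N; last lia.
rewrite iotaD big_cat add0n; congr (_ + _); last by rewrite addKn.
by rewrite !big_cons big_nil /= addr0.
Qed.

(** It suffices that [odd_theta y >= 0.61 y], because [exp(-1/2) <= 0.61]. This follows from
    [theta_ge] at the even number [2 (y %/ 2)], with [r] its integer square root. *)
Lemma odd_theta_ge y : (2 ^ 14 <= y)%N -> ln y%:R - 1 / 2 <= ln (odd_theta R y).
Proof.
move=> y14; have X14 := natr_ge_pow14 _ y14.
have y0 : (0 < y)%N by apply: leq_trans y14.
set n := y./2.
have ny : (y <= n.*2.+1)%N /\ (n.*2 <= y)%N by rewrite /n; lia.
have n14 : (2 ^ 14 <= n.*2)%N.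
  move: y14; rewrite -[(2 ^ 14)%N]/(2 * 2 ^ 13)%N; move: (2 ^ 13)%N ny => k; lia.
have n0 : (0 < n)%N by have := leq_trans (isT : 0 < 2 ^ 14)%N n14; lia.
have [r [rn nr]] : exists r, (r ^ 2 <= n.*2)%N /\ (n.*2 < r.+1 ^ 2)%N.
  have ex : exists r, (r ^ 2 <= n.*2)%N by exists 0%N.
  have ub r : (r ^ 2 <= n.*2)%N -> (r <= n.*2)%N.
    by apply: leq_trans; case: r => // r; rewrite expnS expn1 leq_pmull.
  case: (ex_maxnP ex ub) => r rn rmax; exists r; split => //.
  by rewrite ltnNge; apply/negP => /rmax; rewrite ltnn.
have r128 : (128 <= r)%N.
  have : (2 ^ 14 < r.+1 ^ 2)%N by apply: leq_ltn_trans nr.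
  by rewrite -[14%N]/(7 * 2)%N expnM ltn_exp2r.
have th := @theta_ge R n r n0 nr.
have thy : theta R n.*2 <= theta R y.
  rewrite !theta_ln ler_ln ?posrE ?ltr0n ?primorial_gt0 // ler_nat.
  have [e|e] : y = n.*2 \/ y = n.*2.+1 by lia.
    by rewrite e.
  by rewrite e primorialS leq_pmulr //; case: ifP.
have odd : odd_theta R y = theta R y - ln 2.
  rewrite /theta prime_sum_odd_primes; last by apply: leq_trans y14.
  by rewrite addrC addKr.
have lnr : ln n.*2%:R <= 2 * (ln 2 *+ 7 + (r.+1%:R - 2 ^+ 7) / 2 ^+ 7) :> R.
  apply: (@le_trans _ _ (2 * ln r.+1%:R)).
    by have := @ln_nat_pow_le R 1 2 r.+1 n.*2; rewrite mul1r; apply => //; [rewrite double_gt0|rewrite expn1 ltnW].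
  rewrite ler_pM2l //; have := @ln_sub_le R r.+1%:R (2 ^+ 7).
  rewrite ltr0n exprn_gt0 // => /(_ isT isT); rewrite lnXn //; lra.
have main : 61 / 100 * y%:R <= odd_theta R y.
  have l2 := ln2_lt R; have l20 := ln2_gt R.
  have Y : y%:R <= n.*2%:R + 1 :> R by rewrite natr1 ler_nat; case: ny.
  have r2 : r%:R ^+ 2 <= n.*2%:R :> R by rewrite -natrX ler_nat.
  have R128 : 128 <= r%:R :> R by rewrite ler_nat.
  move: th lnr; rewrite -[r.+1%:R]natr1 odd.
  have r0 : 0 < r%:R + 1 :> R by lra.
  move=> th lnr; have {lnr} := ler_wpM2l (ltW r0) lnr; move: th.
  move: (theta R n.*2) (theta R y) (n.*2%:R) (ln n.*2%:R) (ln 2) (r%:R) (y%:R) 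
   thy l2 l20 Y r2 R128 {r0} => t ty N L l s Y thy l2 l20 hY s2 s128.
  have [z z0 sE] : exists2 z, 0 <= z & s = 128 + z by exists (s - 128); lra.
  rewrite {}sE {s128} in s2 *; move=> th lnr.
  have h1 : 0 <= (N - (128 + z) ^+ 2) * (l - 61 / 100) by apply: mulr_ge0; lra.
  have h2 : 0 <= (128 + z) ^+ 2 * (l - 693 / 1000) by apply: mulr_ge0; [exact: sqr_ge0|lra].
  have h3 : 0 <= (128 + z + 1) * (1733 / 2500 - l) by apply: mulr_ge0; lra.
  have h4 : 0 <= z ^+ 2 by exact: sqr_ge0.
  lra.
have e : expR (- (1 / 2)) <= 61 / 100 :> R.
  have := @expR_ge_taylor R (1/2) 4; rewrite !big_nat_recr //= big_nil /factorial /=.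
  rewrite expRN => h; rewrite -[leRHS]invrK lef_pV2 ?posrE ?expR_gt0 //.
  by apply: le_trans (h _); lra.
have yR : 0 < y%:R :> R by rewrite ltr0n.
rewrite -ler_expR lnK ?posrE; last by apply: lt_le_trans main; rewrite mulr_gt0.
rewrite expRD lnK ?posrE // mulrC; apply: le_trans main.
by rewrite ler_pM2r.
Qed.

Lemma mertens_prodS y : mertens_prod R y.+1 =
  mertens_prod R y * if (2 <= y)%N && prime y.+1 then 1 + y.+1%:R^-1 else 1.
Proof.
rewrite /mertens_prod odd_primesS; case: ifP => _; last by rewrite mulr1.
by rewrite -cats1 big_cat big_seq1.
Qed.

Lemma mertens_prod_gt0 y : 0 < mertens_prod R y.
Proof. by rewrite prodr_gt0 // => p _; rewrite ltr_wpDr // invr_ge0. Qed.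

(* Abel summation of [sum 1/p] against [1 / ln]: the bound on [mertens_sum] makes
   [ln (mertens_prod y) - mertens_sum y / ln y - ln (ln y)] nonincreasing. *)
Lemma ln_mertens_prod_le x y : (2 <= x)%N -> (x <= y)%N ->
  (forall n, (x <= n)%N -> mertens_sum R n <= ln n%:R) ->
  ln (mertens_prod R y) - mertens_sum R y / ln y%:R - ln (ln y%:R) <=
  ln (mertens_prod R x) - mertens_sum R x / ln x%:R - ln (ln x%:R).
Proof.
move=> x2 xy M; elim: y xy => [|y IH]; first by rewrite leqn0 => /eqP ->.
rewrite leq_eqVlt => /orP[/eqP -> //|]; rewrite ltnS => xy.
have y2 := leq_trans x2 xy.
apply: le_trans (IH xy); have My := M y xy.
have Y0 : 0 < y%:R :> R by rewrite ltr0n (leq_trans _ y2).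
have v0 : 0 < ln y%:R :> R by rewrite ln_gt0 // ltr1n.
have vu : ln y%:R < ln y.+1%:R :> R by rewrite ltr_ln ?posrE ?ltr0n ?ltr_nat // (leq_trans _ y2).
have u0 := lt_trans v0 vu.
have hln := @ln_sub_le R _ _ v0 u0.
(* The bound on [mertens_sum] enters here, against a nonnegative factor; the result is compensated
   by the growth of [ln (ln y)] in [hln]. *)
have key : mertens_sum R y * ((ln y%:R)^-1 - (ln y.+1%:R)^-1) <= 1 - ln y%:R / ln y.+1%:R.
  apply: le_trans (_ : ln y%:R * ((ln y%:R)^-1 - (ln y.+1%:R)^-1) <= _).
    by rewrite ler_wpM2r // subr_ge0 lef_pV2 ?posrE // ltW.
  by rewrite mulrBr divff // gt_eqF.
have uu : ln y.+1%:R / ln y.+1%:R = 1 :> R by rewrite divff // gt_eqF.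
rewrite mulrBl uu in hln; rewrite mulrBr in key.
have -> : mertens_sum R y.+1 =
    mertens_sum R y + if prime y.+1 then ln y.+1%:R / y.+1%:R else 0.
  by rewrite /mertens_sum prime_sumS.
rewrite mertens_prodS y2 andTb; case: ifP => _.
  have p0 : 0 < 1 + y.+1%:R^-1 :> R by rewrite ltr_wpDr // invr_ge0.
  rewrite lnM ?posrE ?mertens_prod_gt0 // mulrDl [_ / y.+1%:R / _]mulrAC uu mul1r.
  have : ln (1 + y.+1%:R^-1) <= y.+1%:R^-1 :> R.
    by apply: le_ln1Dx; apply: lt_le_trans (_ : 0 <= _); rewrite ?invr_ge0.
    move: (mertens_sum R y / ln y%:R) (mertens_sum R y / ln y.+1%:R)
    (ln y%:R / ln y.+1%:R) (ln (ln y%:R)) (ln (ln y.+1%:R)) (y.+1%:R^-1 : R)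
    (ln (1 + _)) key hln => a b c d e f g key hln; lra.
rewrite mulr1 addr0.
move: (mertens_sum R y / ln y%:R) (mertens_sum R y / ln y.+1%:R)
  (ln y%:R / ln y.+1%:R) (ln (ln y%:R)) (ln (ln y.+1%:R)) key hln => a b c d e key hln; lra.
Qed.

End Asymptotic.

(** * Computation up to 2^14 *)

(** All primes below 131, enough for trial division below [131 * 131], which exceeds [2^14]. *)
Definition small_primes : seq N :=
  [:: 2; 3; 5; 7; 11; 13; 17; 19; 23; 29; 31; 37; 41; 43; 47; 53; 59; 61; 67; 71;
      73; 79; 83; 89; 97; 101; 103; 107; 109; 113; 127]%num.

Fixpoint trial_division (n : N) (ps : seq N) : bool :=
  if ps is p :: ps' then
    if (n <? p * p)%num then true
    else if (n mod p =? 0)%num then false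
    else trial_division n ps'
  else true.

Lemma Neqb_mod_dvdn (a b : N) : (0 < N.to_nat b)%N ->
  (a mod b =? 0)%num = (N.to_nat b %| N.to_nat a)%N.
Proof.
move=> b0; have E : (N.to_nat a = N.to_nat (a / b)%num * N.to_nat b + N.to_nat (a mod b)%num)%N.
  by have := N.div_mod' a b; nia.
have lt : (N.to_nat (a mod b)%num < N.to_nat b)%N.
  by have := N.mod_lt a b; lia.
by rewrite E dvdn_addr ?dvdn_mull // /dvdn modn_small //; apply/N.eqb_spec/eqP; lia.
Qed.

(** The least prime factor [q] of a composite [n] satisfies [q * q <= n], so it is listed; as the
    list increases, the early exit cannot occur before [q]. *)
Lemma trial_divisionP n : (1 < N.to_nat n)%N -> (n < 131 * 131)%num ->
  trial_division n small_primes = prime (N.to_nat n).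
Proof.
move=> n1 nlt.
have spP : all (fun p => prime (N.to_nat p)) small_primes by vm_compute.
have sps : sorted (fun p q => N.to_nat p < N.to_nat q)%N small_primes by vm_compute.
have [pn|npn] := boolP (prime (N.to_nat n)).
  elim: small_primes spP {sps} => //= p ps IH /andP[pp /IH ->].
  case: ifP => // /N.ltb_ge pn2; rewrite Neqb_mod_dvdn ?prime_gt0 //.
  by rewrite dvdn_prime2 //; case: eqP => // pE; have := prime_gt1 pp; nia.
set q := pdiv (N.to_nat n).
have pq : prime q := pdiv_prime n1.
have qn : (q %| N.to_nat n)%N := pdiv_dvd _.
have qq : (q * q <= N.to_nat n)%N.
  rewrite leqNgt; apply: contra npn => h; apply: ltn_pdiv2_prime; first exact: ltnW.
  by rewrite expnS expn1.
have q131 : (q < 131)%N by nia.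
have : N.of_nat q \in small_primes.
  have : all (fun r => prime r ==> (N.of_nat r \in small_primes)) (iota 0 131) by vm_compute.
  by move=> /allP/(_ q); rewrite mem_iota q131 pq => /(_ isT).
elim: small_primes spP sps => //= p ps IH /andP[pp spP] sps.
have sps' := path_sorted sps.
have plt r : r \in ps -> (N.to_nat p < N.to_nat r)%N.
  move: sps; rewrite path_sortedE; last by move=> x y z; exact: ltn_trans.
  by move=> /andP[/allP h _] /h.
rewrite inE => /orP[/eqP E|qps].
  have {}E : N.to_nat p = q by rewrite -E Nat2N.id.
  case: ifP => [/N.ltb_lt|_]; first by nia.
  by rewrite Neqb_mod_dvdn ?prime_gt0 // E qn.
case: ifP => [/N.ltb_lt|_]; first by have := plt _ qps; rewrite Nat2N.id; nia.
by case: ifP => // _; exact: IH.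
Qed.

Definition scale : N := (2 ^ 40)%num.

(* [64 * log2_unit / scale] is just below [693 / 1000 < ln 2]. *)
Definition log2_unit : N := (scale * 693 / 64000)%num.

(** For positive [x] this is the floor of [64 log2 x]: six binary digits of the logarithm from
    integer arithmetic. *)
Definition lg64 (x : N) : N := N.log2 (x ^ 64)%num.

(* Fixed-point numbers, in units of [1 / scale]: all fields are lower bounds, except
   [st_prod], which is an upper bound (see [loop_inv]). *)
Record state := State {
  st_prod : N; st_mertens : N; st_theta : N; st_ln : N; st_bound : N }.

(* A lower bound for [0.888 ln theta] from one for [theta].  As [t / 2 ^ 30] stands
   for [2 ^ 10 theta], [64 * 10] is subtracted from its scaled logarithm; 111/125 is
   0.888.  Truncated subtraction makes the bound 0 when [theta] is too small. *)
Definition lnln_bound (t : N) : N :=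
  ((lg64 (t / 2 ^ 30) - 640) * log2_unit * 111 / 125)%num.

(* Above 128, [ln n >= ln (n - 1) + 1 / n] replaces the costlier [lg64].  The bound
   is only recomputed when the product has overtaken it. *)
Definition step (n : N) (s : state) : state :=
  let l := if (n <=? 128)%num then (lg64 n * log2_unit)%num
           else (st_ln s + scale / n)%num in
  if trial_division n small_primes then
    let p := (st_prod s + st_prod s / n + 1)%num in
    let t := (st_theta s + l)%num in
    State p (st_mertens s + l / n)%num t l
      (if (p <? st_bound s)%num then st_bound s else lnln_bound t)
  else State (st_prod s) (st_mertens s) (st_theta s) l (st_bound s).

Fixpoint run (k : nat) (n : N) (s : state) : option state :=
  if k is k'.+1 then
    let s' := step n s in
    if (n <? 19)%num || (st_prod s' <? st_bound s')%num then run k' (N.succ n) s'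
    else None
  else Some s.

(** The state at [n = 2]: the prime 2 counts in the Mertens sum, as [ln 2 / 2], but not in the
    product or in [theta]. *)
Definition init_state : state :=
  State scale (32 * log2_unit)%num 0%num (64 * log2_unit)%num 0%num.

(** The data at [2^14] that start the partial summation: product below 7.012, Mertens sum above
    8.37. *)
Definition final_ok (s : state) : bool :=
  (st_prod s * 250 <? scale * 1753)%num && (scale * 837 <? st_mertens s * 100)%num.

Lemma run_init : oapp final_ok false (run (N.to_nat 16382) 3 init_state).
Proof. by vm_compute. Qed.

Lemma oapp_someP (T : Type) (P : pred T) (o : option T) :
  oapp P false o -> exists2 x, o = Some x & P x.
Proof. by case: o => // x Px; exists x. Qed.

Fixpoint harmonic_floor (k : nat) : N :=
  if k is k'.+1 then (harmonic_floor k' + scale / N.of_nat k)%num else 0%num.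

Lemma harmonic_floor255 : (scale * 153 <? harmonic_floor 255 * 25)%num.
Proof. by vm_compute. Qed.

(** * Correctness of the fixed-point computation *)

Section Numerics.
Variable R : realType.

Definition NtoR (x : N) : R := (N.to_nat x)%:R.

Local Notation inR := NtoR.

Lemma inR_ge0 x : 0 <= inR x. Proof. by []. Qed.

Lemma inRD x y : inR (x + y)%num = inR x + inR y.
Proof. by rewrite -natrD; congr _%:R; lia. Qed.

Lemma inRM x y : inR (x * y)%num = inR x * inR y.
Proof. by rewrite -natrM; congr _%:R; lia. Qed.

Lemma inRX x n : inR (x ^ N.of_nat n)%num = inR x ^+ n.
Proof.
elim: n => [|n IH]; first by [].
by rewrite Nat2N.inj_succ N.pow_succ_r' inRM IH exprS.
Qed.

Lemma inR_le x y : (x <= y)%num -> inR x <= inR y.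
Proof. by move=> xy; rewrite ler_nat; lia. Qed.

Lemma inR_lt x y : (x < y)%num -> inR x < inR y.
Proof. by move=> xy; rewrite ltr_nat; lia. Qed.

Lemma inR_gt0 x : (0 < x)%num -> 0 < inR x.
Proof. exact: inR_lt. Qed.

Lemma inR_div_le x y : (0 < y)%num -> inR (x / y)%num <= inR x / inR y.
Proof.
move=> y0; rewrite ler_pdivlMr ?inR_gt0 // mulrC -inRM; apply: inR_le.
by apply: N.Div0.mul_div_le.
Qed.

Lemma inR_div_gt x y : (0 < y)%num -> inR x / inR y < inR (x / y)%num + 1.
Proof.
move=> y0; rewrite ltr_pdivrMr ?inR_gt0 // mulrC -[1]/(inR 1) -inRD -inRM; apply: inR_lt.
by rewrite N.add_1_r; apply: N.mul_succ_div_gt; lia.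
Qed.

Lemma scale_gt0 : 0 < inR scale. Proof. exact: inR_gt0. Qed.

Lemma log2_unit_le : 64 * inR log2_unit <= inR scale * ln 2.
Proof.
have /inR_le : (log2_unit * 64000 <= scale * 693)%num by [].
rewrite !inRM (_ : inR 64000 = 64 * 1000); last first.
  by rewrite -[64000%num]/(64 * 1000)%num inRM.
rewrite (_ : inR 693 = 693%:R) //.
have := ler_wpM2l (ltW scale_gt0) (ltW (ln2_gt R)).
by move: (inR scale) (inR log2_unit) => s u; lra.
Qed.

Lemma lg64_le x : (0 < x)%num -> inR (lg64 x) * ln 2 <= 64 * ln (inR x).
Proof.
move=> x0; rewrite /lg64; set g := N.log2 _.
have : (2 ^ N.of_nat (N.to_nat g) <= x ^ N.of_nat 64)%num.
  rewrite N2Nat.id; apply: (proj1 (N.log2_spec _ _)).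
  have x64 : (x ^ 64 <> 0)%num by apply: N.pow_nonzero; lia.
  by move: (x ^ 64)%num x64 => y; lia.
move=> /inR_le; rewrite !inRX => h.
have xR := inR_gt0 _ x0.
rewrite /NtoR -/(NtoR x) mulr_natl -[64]/(64%:R) mulr_natl -!lnXn //.
by rewrite ler_ln ?posrE ?exprn_gt0.
Qed.

End Numerics.

Section Loop.
Variable R : realType.
Local Notation inR := (NtoR R).

Lemma inR1 : inR 1 = 1. Proof. by []. Qed.

Lemma scaleE : inR scale = 2 ^+ 40.
Proof. by rewrite -[scale]/(2 ^ N.of_nat 40)%num inRX. Qed.

Opaque scale log2_unit.

Lemma bound_factorE : inR 111 / inR 125 = 111 / 125.
Proof. by []. Qed.

Lemma lnln_bound_le (t : N) (th : R) : inR t <= inR scale * th ->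
  (0 < lnln_bound t)%num ->
  0 < th /\ inR (lnln_bound t) <= inR scale * (111 / 125) * ln th.
Proof.
rewrite /lnln_bound; set u := (t / _)%num; set g := lg64 u => tth B0.
(* A positive bound shows that the truncated subtraction did not saturate. *)
have g640 : (640 < g)%num.
  rewrite N.lt_nge => h; move: B0; rewrite (proj2 (N.sub_0_le _ _) h).
  by rewrite !N.mul_0_l N.div_0_l.
have u0 : (0 < u)%num.
  by rewrite N.lt_nge => /N.le_0_r E; move: g640; rewrite /g E.
have uR := inR_gt0 R _ u0.
have sR := scale_gt0 R.
have uth : inR u <= 2 ^+ 10 * th.
  have : inR u <= inR t / inR (2 ^ N.of_nat 30)%num by apply: inR_div_le.
  rewrite inRX ler_pdivlMr ?exprn_gt0 // => h.
  have sE : inR scale = 2 ^+ 30 * 2 ^+ 10.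
    by rewrite -exprD scaleE.
  have := le_trans h tth; rewrite sE -mulrA mulrC ler_pM2l ?exprn_gt0 //.
have th0 : 0 < th by have := lt_le_trans uR uth; rewrite pmulr_rgt0 // exprn_gt0.
split => //.
have lgu := lg64_le R u u0.
have lnu : ln (inR u) <= ln 2 *+ 10 + ln th.
  rewrite -lnXn // -lnM ?posrE ?exprn_gt0 // ler_ln ?posrE //.
  by rewrite mulr_gt0 ?exprn_gt0.
have gE : inR g = inR (g - 640)%num + 640.
  rewrite -[640 : R]/(inR 640) -inRD; congr (inR _); lia.
apply: le_trans (inR_div_le R _ _ _) _ => //; rewrite !inRM -/g.
rewrite -mulrA bound_factorE.
have unit := log2_unit_le R.
have a0 : 0 <= inR (g - 640)%num by exact: inR_ge0.
have := ler_wpM2l a0 unit.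
have l2 : inR (g - 640)%num * ln 2 <= 64 * ln th.
  by move: lgu lnu; rewrite -/g gE; move: (inR (g - 640)%num) (ln 2) (ln th) (ln (inR u)) => a b c d; clear - a b c d; lra.
have := ler_wpM2l (ltW sR) l2.
move: (inR (g - 640)%num) (inR log2_unit) (inR scale) (ln th) (ln 2) => a b c d e; clear - a b c d e; lra.
Qed.

(** A zero [st_bound] stands for no information. Positivity of [odd_theta] is recorded so that an
    old bound survives, by monotonicity of [ln], when [odd_theta] grows. *)
Definition loop_inv (n : N) (s : state) : Prop :=
  [/\ inR scale * mertens_prod R (N.to_nat n) <= inR (st_prod s),
      inR (st_mertens s) <= inR scale * mertens_sum R (N.to_nat n),
      inR (st_theta s) <= inR scale * odd_theta R (N.to_nat n),
      inR (st_ln s) <= inR scale * ln (inR n) &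
      (0 < st_bound s)%num -> 0 < odd_theta R (N.to_nat n) /\
        inR (st_bound s) <= inR scale * (111 / 125) * ln (odd_theta R (N.to_nat n))].

Lemma odd_thetaS y : odd_theta R y.+1 =
  odd_theta R y + if (2 <= y)%N && prime y.+1 then ln y.+1%:R else 0.
Proof.
rewrite /odd_theta odd_primesS; case: ifP => _; last by rewrite addr0.
by rewrite -cats1 big_cat big_seq1.
Qed.

Lemma step_ln (n : N) (s : state) : (1 < n)%num -> inR (st_ln s) <= inR scale * ln (inR n) ->
  inR (st_ln (step (N.succ n) s)) <= inR scale * ln (inR (N.succ n)).
Proof.
move=> n1 hl; have -> : st_ln (step (N.succ n) s) =
    if (N.succ n <=? 128)%num then (lg64 (N.succ n) * log2_unit)%num
    else (st_ln s + scale / N.succ n)%num by rewrite /step; case: ifP.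
have sR := ltW (scale_gt0 R).
have m0 : 0 < inR (N.succ n) by apply: inR_gt0; lia.
have n0 : 0 < inR n by apply: inR_gt0; lia.
case: ifP => _.
  have lg := @lg64_le R (N.succ n) ltac:(lia).
  have := ler_wpM2l (inR_ge0 R (lg64 (N.succ n))) (log2_unit_le R).
  have := ler_wpM2l sR lg; rewrite inRM.
  by move: (inR (lg64 _)) (inR log2_unit) (inR scale) (ln (inR (N.succ n))) (ln 2) => a b c d e; clear - a b c d e; lra.
have := inR_div_le R scale (N.succ n) ltac:(lia).
have := ler_wpM2l sR (ln_sub_le R _ _ n0 m0).
have -> : (inR n - inR (N.succ n)) / inR (N.succ n) = - (inR (N.succ n))^-1.
  by rewrite -[N.succ n]N.add_1_r inRD inR1 opprD addNKr mulN1r.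
rewrite inRD; move: (inR (scale / _)%num) (inR scale) (inR (st_ln s)) (_^-1) (ln (inR n)) (ln (inR (N.succ n))) hl.
by move=> a b c d e f; clear - a b c d e f; nra.
Qed.

Lemma step_inv n s : (1 < n)%num -> (N.succ n < 131 * 131)%num ->
  loop_inv n s -> loop_inv (N.succ n) (step (N.succ n) s).
Proof.
have f0 : 0 <= 111 / 125 :> R by lra.
have mE : N.to_nat (N.succ n) = (N.to_nat n).+1 by lia.
have mN : (0 < N.succ n)%num by lia.
move=> n1; have n2 : (2 <= N.to_nat n)%N by lia.
move=> nlt [hP hM hT hL hB]; have hL' := step_ln n s n1 hL.
have m0 : 0 < inR (N.succ n) by exact: inR_gt0.
have tdE : trial_division (N.succ n) small_primes = prime (N.to_nat n).+1.
  by rewrite -mE; apply: trial_divisionP nlt; rewrite mE; exact: leqW.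
have lnm0 : 0 <= ln (inR (N.succ n)) by exact: ln_prime_ge0.
have sR := scale_gt0 R.
have hPS := mertens_prodS R (N.to_nat n).
have hTS := odd_thetaS (N.to_nat n).
rewrite n2 andTb in hPS; rewrite n2 andTb in hTS.
have hMS : mertens_sum R (N.to_nat n).+1 = mertens_sum R (N.to_nat n) +
    if prime (N.to_nat n).+1 then ln (inR (N.succ n)) / inR (N.succ n) else 0.
  by rewrite /mertens_sum prime_sumS /NtoR mE.
rewrite /loop_inv mE hPS hTS hMS.
move: hL'; rewrite /step tdE.
set l := (if (_ <=? 128)%num then _ else _).
case: ifP => pm /=; last by rewrite mulr1 !addr0 => hL'; split.
rewrite -mE -/(inR (N.succ n)); move: l => l hL'.
have T' : inR (st_theta s + l)%num <= inR scale * (odd_theta R (N.to_nat n) + ln (inR (N.succ n))).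
  by rewrite inRD mulrDr lerD.
split=> //.
(* The [+ 1] in [step] outweighs the rounding down of the quotient. *)
- rewrite !inRD inR1; have := inR_div_gt R (st_prod s) (N.succ n) mN.
  rewrite mulrA => h; apply: le_trans (_ : inR (st_prod s) * (1 + (inR (N.succ n))^-1) <= _).
    by apply: ler_wpM2r hP; rewrite addr_ge0 // invr_ge0 ltW.
  rewrite mulrDr mulr1 -addrA lerD2l; exact: ltW h.
- rewrite inRD mulrDr; apply: (lerD hM).
  apply: le_trans (inR_div_le R _ _ mN) _.
  by rewrite mulrA ler_wpM2r // invr_ge0 ltW.
case: ifP => _; last exact: lnln_bound_le.
move=> /hB [th0 hb]; split; first by rewrite ltr_wpDr.
apply: le_trans hb _; apply: ler_wpM2l; first by apply: (mulr_ge0 (ltW sR) f0).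
by rewrite ler_ln ?posrE ?lerDl ?ltr_wpDr.
Qed.

Lemma run_inv k n s s' : (1 < n)%num -> (n + N.of_nat k < 131 * 131)%num ->
  loop_inv n s -> run k (N.succ n) s = Some s' ->
  loop_inv (n + N.of_nat k)%num s' /\
  forall y, (19 <= y)%N -> (N.to_nat n < y <= N.to_nat n + k)%N ->
    mertens_prod R y < 111 / 125 * ln (odd_theta R y).
Proof.
elim: k n s => [|k IH] n s n1 nk Is.
  by move=> [<-]; rewrite N.add_0_r; split => // y _; lia.
rewrite [run _ _ _]/=; case: ifP => // chk rs.
have Is' := step_inv n s n1 ltac:(lia) Is.
have := IH (N.succ n) _ ltac:(lia) ltac:(lia) Is' rs.
have -> : (N.succ n + N.of_nat k = n + N.of_nat k.+1)%num by lia.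
move=> [I' hy]; split => // y y19 ylt.
have [ynS|ynS] := eqVneq y (N.to_nat (N.succ n)); last by apply: hy => //; lia.
move: chk => /orP[/N.ltb_lt|/N.ltb_lt hb]; first by lia.
case: Is' => hP _ _ _ hB; have [_ hB'] := hB ltac:(lia).
rewrite ynS -(ltr_pM2l (scale_gt0 R)) mulrA.
by apply: le_lt_trans hP (lt_le_trans (inR_lt R _ _ hb) hB').
Qed.

End Loop.

(** * The bound for all y *)

Section Final.
Variable R : realType.
Local Notation inR := (NtoR R).

Lemma init_inv : loop_inv R 2 init_state.
Proof.
have p2 : mertens_prod R 2 = 1 by rewrite /mertens_prod /odd_primes big_nil.
have t2 : odd_theta R 2 = 0 by rewrite /odd_theta /odd_primes big_nil.
have unit := log2_unit_le R.
have m2 : mertens_sum R 2 = ln 2 / 2.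
  by rewrite /mertens_sum prime_sum_odd_primes // /odd_primes big_nil addr0.
rewrite /loop_inv /init_state -[N.to_nat 2]/2%N p2 t2 m2; split.
- by rewrite mulr1 lexx.
- rewrite -[st_mertens _]/(32 * log2_unit)%num inRM (_ : inR 32 = 32); last by [].
  by move: (inR log2_unit) (inR scale) (ln 2) unit => a b c; clear - a b c; lra.
- by rewrite mulr0 lexx.
- by rewrite -[st_ln _]/(64 * log2_unit)%num inRM; exact: unit.
by move=> /N.lt_irrefl.
Qed.

Lemma pow14E : N.to_nat (2 + N.of_nat (N.to_nat 16382)) = (2 ^ 14)%N.
Proof. by rewrite N2Nat.id; vm_compute. Qed.

Lemma loop_result : [/\ mertens_prod R (2 ^ 14) <= 1753 / 250,
    837 / 100 <= mertens_sum R (2 ^ 14) &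
    forall y, (19 <= y)%N -> (y <= 2 ^ 14)%N ->
      mertens_prod R y < 111 / 125 * ln (odd_theta R y)].
Proof.
have [s E /andP[/N.ltb_lt hS /N.ltb_lt hM]] := oapp_someP _ _ _ run_init.
have k14 : (2 + N.of_nat (N.to_nat 16382) < 131 * 131)%num by rewrite N2Nat.id.
have [[hP hM' _ _ _] hy] := run_inv R _ 2%num _ _ (erefl _) k14 init_inv E.
move: hP hM' hy; rewrite pow14E => hP hM' hy.
have sR := scale_gt0 R.
have c1753 : inR 1753 = 1753 by [].
have c837 : inR 837 = 837 by [].
have c250 : inR 250 = 250 by []. have c100 : inR 100 = 100 by [].
split.
- rewrite -(ler_pM2l sR); apply: le_trans hP _.
  have := ltW (inR_lt R _ _ hS); rewrite !inRM c1753 c250.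
  by move: (inR (st_prod s)) (inR scale) => a b; clear - a b; lra.
- rewrite -(ler_pM2l sR); apply: le_trans hM'.
  have := ltW (inR_lt R _ _ hM); rewrite !inRM c837 c100.
  by move: (inR (st_mertens s)) (inR scale) => a b; clear - a b; lra.
have k14E : (N.to_nat 2 + N.to_nat 16382 = 2 ^ 14)%N.
  by rewrite -pow14E N2Nat.inj_add Nat2N.id.
move=> y y19 y14; apply: (hy y y19); rewrite k14E y14 andbT.
exact: (@leq_trans 19 3 y isT y19).
Qed.

(** Here [u] is [ln y], [t] is [ln (odd_theta y)], and [P0], [M0], [L0] belong to [2^14]. Since
    [M / u <= 1], the monotone quantity yields [P <= P0 exp(1 - M0 / L0) u / L0], about [0.83 u],
    which leaves room for the loss of 1/2 in [t]. *)
Lemma final_numeric (L0 u P0 P M0 M t : R) :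
  P0 <= 1753 / 250 -> 837 / 100 <= M0 ->
  ln P - M / u - ln u <= ln P0 - M0 / L0 - ln L0 ->
  M <= u -> u - 1 / 2 <= t -> 0 < P0 -> 0 < P ->
  L0 <= 1941 / 200 -> 97 / 10 <= L0 -> L0 <= u ->
  P < 111 / 125 * t.
Proof.
move=> P0le M0ge h My th P0gt0 Pgt0 L0le L0ge uL.
have L00 : 0 < L0 by clear -L0ge; lra.
have u0 : 0 < u := lt_le_trans L00 uL.
have Mu : M / u <= 1 by rewrite ler_pdivrMr // mul1r.
(* [d = 0.1376] is just above [1 - 8.37 / 9.705], and [287 / 250] just above the bound of
   [expR_le_pade] on [exp(d)]. *)
have [d [d0 d2 dML dexp]] : exists d : R, [/\ 0 <= d, d < 2,
    (1 - d) * (1941 / 200) <= 837 / 100 & 1 + d / 2 <= 287 / 250 * (1 - d / 2)].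
  by clear; exists (86 / 625); split; lra.
have ML : 1 - M0 / L0 <= d.
  rewrite lerBlDl -lerBlDr ler_pdivlMr //; apply: le_trans M0ge; apply: le_trans dML.
  have [d1|/ltW d1] := leP 0 (1 - d); first by rewrite ler_wpM2l.
  by move: d1 dexp; clear; lra.
have ed : expR d <= 287 / 250.
  apply: le_trans (@expR_le_pade R d _) _; first by rewrite d0.
  by rewrite ler_pdivrMr // subr_gt0 ltr_pdivrMr // mul1r.
have hP : P <= P0 * expR d * (u / L0).
  rewrite -ler_ln ?posrE ?mulr_gt0 ?divr_gt0 ?expR_gt0 ?invr_gt0 //.
  rewrite !lnM ?posrE ?mulr_gt0 ?divr_gt0 ?expR_gt0 ?invr_gt0 // expRK lnV ?posrE //.
  move: (ln P) (ln P0) (ln u) (ln L0) (M / u) (M0 / L0) h Mu ML => a b c e f g.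
  by clear; lra.
have Pe : P0 * expR d <= 1753 / 250 * (287 / 250).
  by apply: ler_pM => //; rewrite ?expR_ge0 // ltW.
apply: le_lt_trans hP _.
apply: le_lt_trans (_ : 1753 / 250 * (287 / 250) * (u / L0) < _).
  by rewrite ler_wpM2r // divr_ge0 // ltW.
apply: lt_le_trans (_ : 111 / 125 * (u - 1 / 2) <= _); last first.
  by move: th; clear; lra.
rewrite [_ * (u / L0)]mulrA ltr_pdivrMr //; move: L0ge uL; clear => L0ge uL.
(* The two products add up to [u * L0 >= 9.7 u], which makes the goal linear. *)
have : 0 <= (u - L0) * (L0 - 97 / 10) by apply: mulr_ge0; lra.
have : 0 <= L0 * (L0 - 97 / 10) by apply: mulr_ge0; lra.
by lra.
Qed.

Lemma mertens_prod_lt_large y : (2 ^ 14 <= y)%N ->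
  mertens_prod R y < 111 / 125 * ln (odd_theta R y).
Proof.
move=> y14; have [P0le M0ge _] := loop_result.
have Mle n : (2 ^ 14 <= n)%N -> mertens_sum R n <= ln n%:R by exact: mertens_sum_le_ln.
have h := @ln_mertens_prod_le R (2 ^ 14) y isT y14 Mle.
have My := Mle y y14; have th := odd_theta_ge R y y14.
have P0 := mertens_prod_gt0 R (2 ^ 14); have Py := mertens_prod_gt0 R y.
have l2 := ln2_lt R; have l2' := ln2_gt R.
have L0E : ln (2 ^ 14)%:R = 14 * ln 2 :> R by rewrite natrX lnXn // mulr_natl.
have L0le : ln (2 ^ 14)%:R <= 1941 / 200 :> R by rewrite L0E; lra.
have L0ge : 97 / 10 <= ln (2 ^ 14)%:R :> R by rewrite L0E; lra.
have uL : ln (2 ^ 14)%:R <= ln y%:R :> R.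
  by rewrite ler_ln ?posrE ?ltr0n ?expn_gt0 ?ler_nat // (leq_trans _ y14) // expn_gt0.
exact: (final_numeric _ _ _ _ _ _ _ P0le M0ge h My th P0 Py L0le L0ge uL).
Qed.

Lemma mertens_prod_lt y : (19 <= y)%N ->
  mertens_prod R y < 111 / 125 * ln (odd_theta R y).
Proof.
have [_ _ hy] := loop_result; move=> y19.
by have [/ltnW y14|y14] := ltnP (2 ^ 14) y; [exact: mertens_prod_lt_large|exact: hy].
Qed.

(** * Numerical lower bound for [exp(gamma) / 2] *)

Lemma series_harmonicS n : series harmonic n.+1 = series harmonic n + n.+1%:R^-1 :> R.
Proof. by rewrite !seriesEnat /= big_nat_recr. Qed.

(** With [ln (n + 1)] in place of [ln n] the sequence becomes nondecreasing and stays below the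
    original one, so each term bounds the limit from below. *)
Lemma euler_gamma_ge n : series harmonic n - ln n.+1%:R <= euler_gamma R.
Proof.
apply: limr_ge; first exact: is_cvg_euler_gamma_seq.
have mono m : (n <= m)%N -> series harmonic n - ln n.+1%:R <= series harmonic m - ln m.+1%:R :> R.
  elim: m => [|m IH]; first by rewrite leqn0 => /eqP ->.
  rewrite leq_eqVlt => /orP[/eqP -> //|]; rewrite ltnS => /IH /le_trans; apply.
  rewrite series_harmonicS.
  have := ln_sub_le R m.+2%:R m.+1%:R; rewrite !ltr0n => /(_ isT isT).
  rewrite -[m.+2%:R]natr1 addrAC subrr add0r mul1r.
  by move: (ln (m.+1%:R + 1)) (ln m.+1%:R) (m.+1%:R^-1) (series harmonic m) => a b c d; lra.
near=> m.
have nm : (n < m)%N by near: m; exact: nbhs_infty_gt.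
apply: le_trans (mono m (ltnW nm)) _; rewrite /euler_gamma_seq lerD2l lerN2.
by rewrite ler_ln ?posrE ?ltr0n ?ler_nat // (leq_trans _ nm).
Unshelve. all: by end_near.
Qed.

Lemma harmonic_floor_le k : inR (harmonic_floor k) <= inR scale * series harmonic k.
Proof.
elim: k => [|k IH]; first by rewrite seriesEnat /= big_geq // mulr0.
rewrite series_harmonicS mulrDr -[harmonic_floor _]/(_ + scale / N.of_nat k.+1)%num inRD lerD //.
apply: le_trans (inR_div_le R _ _ _) _; first by lia.
by rewrite /NtoR Nat2N.id.
Qed.

Lemma expR_euler_gamma_ge : 111 / 125 <= expR (euler_gamma R) / 2.
Proof.
(* [359 / 625 = 6.12 - 8 * 0.6932]; 255 terms are taken so that the logarithm is [ln 256 = 8 ln 2].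
   The exponential of this number barely exceeds 1.776. *)
have g : 359 / 625 <= euler_gamma R.
  apply: le_trans (euler_gamma_ge 255).
  have c153 : inR 153 = 153 by [].
  have c25 : inR 25 = 25 by [].
  have H : 153 / 25 <= series harmonic 255 :> R.
    have := harmonic_floor_le 255.
    move: (harmonic_floor 255) harmonic_floor255 => x /N.ltb_lt/(inR_lt R)/ltW.
    rewrite !inRM c153 c25; have := scale_gt0 R.
    by move: (inR scale) (inR x) (series harmonic 255) => a b c; clear - a b c; nra.
  have -> : ln 256%:R = ln 2 *+ 8 :> R by rewrite -lnXn // -natrX.
  by have := ln2_lt R; move: (series harmonic 255) H => a; lra.
rewrite ler_pdivlMr //; apply: le_trans (_ : expR (359 / 625) <= _); last by rewrite ler_expR.
apply: le_trans (@expR_ge_taylor R (359 / 625) 8 _); last by lra.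
by rewrite !big_nat_recr //= big_nil /factorial /=; lra.
Qed.

End Final.

Theorem theorem5p1 (R : realType) (n : nat) :
  odd n -> squarefree n -> (4849845 <= n)%N ->
  (sigma n)%:R / (n%:R * ln (ln n%:R)) < expR (euler_gamma R) / 2 :> R.
Proof.
move=> on sq nbig.
have nR : 4849845%:R <= n%:R :> R by rewrite ler_nat; exact: nbig.
clear nbig.
have f0 : 0 <= 111 / 125 :> R by lra.
have h := sigma_bound R _ n f0 (mertens_prod_lt R) on sq nR.
have n0 : 0 < n%:R :> R by move: (n%:R) nR => x; lra.
have s0 : 0 <= (sigma n)%:R / n%:R :> R by rewrite divr_ge0.
(* The bound [h] itself gives the sign: its left side is nonnegative. *)
have ll0 : 0 < ln (ln n%:R) :> R.
  by have := le_lt_trans s0 h; rewrite pmulr_rgt0 //; lra.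
apply: lt_le_trans (expR_euler_gamma_ge R).
by rewrite invfM mulrA ltr_pdivrMr.
Qed.
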